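(* Let $(m_j)_{j=1}^{\infty}$ be a strictly increasing sequence of positive integers with $m_{j+1}\ge q\,m_j$ for all $j$, where $q\ge 2$. Let $A_j>0$, $B_j\in\mathbb{C}$ satisfy $A_j^2-|B_j|^2=1$ for all $j$, and assume $\sum_{j=1}^{\infty}\log(A_j^2+|B_j|^2)<\infty$. Then for almost every $t\in\mathbb{T}$ the limit $$\lim_{N\to\infty}\prod_{j=1}^{N}\begin{bmatrix} A_j & B_j e^{2\pi i m_j t}\\ \overline{B_j}e^{-2\pi i m_j t} & A_j\end{bmatrix}$$ (factors multiplied in increasing order of $j$ from left to right) exists in $\mathrm{SU}(1,1)$.
   Context: $\mathbb{T}=\mathbb{R}/\mathbb{Z}$ with Lebesgue measure. $\mathrm{SU}(1,1)=\{\begin{bmatrix} A & B\\ \overline{B} & \overline{A}\end{bmatrix}: A,B\in\mathbb{C},\ |A|^2-|B|^2=1\}$, with convergence understood with respect to the complete metric $\rho(G_1,G_2)=\log(1+\|G_1^{-1}G_2-I_2\|_{op})$ (equivalently, entrywise convergence within $\mathrm{SU}(1,1)$). *)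

(* Defs.v *)
(* complex numbers from mathcomp-real-closed. *)
From HB Require Import structures.
From mathcomp Require Import all_boot all_order all_algebra.
From mathcomp Require Import all_classical all_reals all_analysis.
From mathcomp Require Import complex.
Set Implicit Arguments. Unset Strict Implicit. Unset Printing Implicit Defensive.
Import Order.TTheory GRing.Theory Num.Theory ComplexField.
Notation normc := ComplexField.Normc.normc.
Import numFieldNormedType.Exports.
Local Open Scope ring_scope.
Local Open Scope complex_scope.
Local Open Scope classical_set_scope.

(* e^{i x} as an element of R[i] *)
Definition expi (R : realType) (x : R) : R[i] := cos x +i* sin x.

(* The j-th factor [[A, B e^{2 pi i m t}], [conj B e^{-2 pi i m t}, A]] *)
Definition su11_factor (R : realType) (A : R) (B : R[i]) (m : nat) (t : R)
  : 'M[R[i]]_2 :=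
  \matrix_(r < 2, c < 2)
    if r == ord0 then
      (if c == ord0 then A%:C else B * expi (2 * pi * m%:R * t))
    else
      (if c == ord0 then B^* * expi (- (2 * pi * m%:R * t)) else A%:C).

(* Ordered partial product F 0 * F 1 * ... * F (N-1), left to right *)
Definition partial_prod (R : realType) (F : nat -> 'M[R[i]]_2) (N : nat)
  : 'M[R[i]]_2 := \prod_(j < N) F j.

(* SU(1,1) *)
Definition SU11 (R : realType) (G : 'M[R[i]]_2) : Prop :=
  exists (a b : R[i]),
    G = \matrix_(r < 2, c < 2)
          (if r == ord0 then (if c == ord0 then a else b)
           else (if c == ord0 then b^* else a^*))
    /\ normc a ^+ 2 - normc b ^+ 2 = 1.

(* Convergence of a sequence of 2x2 complex matrices, entrywise
   (equivalent within SU(1,1) to convergence for the metric rho). *)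
Definition mx_cvg_to (R : realType) (P : nat -> 'M[R[i]]_2) (G : 'M[R[i]]_2)
  : Prop :=
  forall r c : 'I_2,
    (fun N => complex.Re (P N r c)) @ \oo --> complex.Re (G r c) /\
    (fun N => complex.Im (P N r c)) @ \oo --> complex.Im (G r c).

(* Main.v *)
(* Write z = e^{2 pi i t} and let (a, b) be the first row of the N-th partial product.
   Divided by A_0 ... A_(N-1), both z conj(a) + b and z conj(a) - b satisfy a recursion
   u_{N+1} = u_N +- (B_N / A_N) z^{m_N + 1} conj(u_N).  Since m_{N+1} >= 2 m_N, the
   increment has, for N >= 1, frequencies strictly above those of u_N, so u_N is the partial sum, cut
   at frequency m_(N-1), of one fixed power series, and orthogonality turns the
   summability hypothesis into a uniform l^2 bound on its coefficients.  What remains is Kolmogorov's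
   theorem that lacunary partial sums of an l^2 trigonometric series converge almost
   everywhere: the sum cut at K differs from the average of the whole series over the
   ball of radius 1/(2 pi K) by an error that is square summable along the lacunary
   cut-offs, and the averages are controlled by the Hardy-Littlewood maximal
   function. *)
Require Import Defs.
From HB Require Import structures.
From mathcomp Require Import all_boot all_order all_algebra.
From mathcomp Require Import all_classical all_reals all_analysis.
From mathcomp Require Import complex.
From mathcomp Require Import measurable_realfun ring lra zify.
Import Order.TTheory GRing.Theory Num.Theory ComplexField.
Import numFieldNormedType.Exports.
Local Open Scope ring_scope.
Local Open Scope complex_scope.
Local Open Scope classical_set_scope.

Set Implicit Arguments.
Unset Strict Implicit.
Unset Printing Implicit Defensive.

(** * Integrals of trigonometric polynomials *)

Section TrigPoly.
Context {R : realType}.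
Local Notation mu := (@lebesgue_measure R).

(** An integral encoded by a global antiderivative: linearity then needs no integrability side
    conditions, and [has_int_integral] returns to the Lebesgue integral by the fundamental theorem
    of calculus. *)
Definition has_int (a b : R) (f : R -> R) (v : R) : Prop :=
  exists2 F : R -> R, (forall t : R, is_derive t 1 F (f t)) & F b - F a = v.

Lemma has_intD a b f g u v : has_int a b f u -> has_int a b g v ->
  has_int a b (fun t => f t + g t) (u + v).
Proof.
move=> [F dF <-] [G dG <-]; exists (F + G).
  by move=> t; apply: is_deriveD.
by rewrite /= !fctE; ring.
Qed.

Lemma has_intZ a b f v c : has_int a b f v ->
  has_int a b (fun t => c * f t) (c * v).
Proof.
move=> [F dF <-]; exists (c *: F).
  by move=> t; apply: is_deriveZ.
by rewrite !fctE /GRing.scale /=; ring.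
Qed.

Lemma has_int_cst a b c : has_int a b (fun=> c) (c * (b - a)).
Proof.
exists (c *: id); last by rewrite !fctE /GRing.scale /=; ring.
move=> t; have -> : c = c *: (1 : R) by rewrite /GRing.scale /= mulr1.
by rewrite [in X in is_derive _ _ X]/GRing.scale /= mulr1; apply: is_deriveZ.
Qed.

Lemma has_int_sum a b n (f : nat -> R -> R) (v : nat -> R) :
  (forall i, (i < n)%N -> has_int a b (f i) (v i)) ->
  has_int a b (fun t => \sum_(i < n) f i t) (\sum_(i < n) v i).
Proof.
elim: n => [|n IH] H.
  rewrite big_ord0 (_ : (fun _ => _) = fun=> 0).
    by have := has_int_cst a b 0; rewrite mul0r.
  by apply/funext => t; rewrite big_ord0.
rewrite big_ord_recr /= (_ : (fun _ => _) =
  fun t => (\sum_(i < n) f i t) + f n t); last first.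
  by apply/funext => t; rewrite big_ord_recr.
by apply: has_intD; [apply: IH => i /ltnW; apply: H|apply: H].
Qed.

Lemma has_int_integral a b f v : a < b -> continuous f -> has_int a b f v ->
  (\int[mu]_(t in `[a, b]) (f t)%:E = v%:E)%E.
Proof.
move=> ab cf [F dF <-].
have cF t : {for t, continuous F}.
  by apply: differentiable_continuous; apply/derivable1_diffP; exact: ex_derive.
rewrite (continuous_FTC2 ab (F := F)) ?EFinB//.
- exact: continuous_subspaceT.
- split; first by move=> t _; exact: ex_derive.
  + by apply: cvg_at_right_filter; exact: cF.
  + by apply: cvg_at_left_filter; exact: cF.
- by move=> t _; rewrite derive1E; exact: derive_val.
Qed.

Definition wave (x y w t : R) : R := x * cos (w * t) + y * sin (w * t).

Lemma continuous_wave x y w : continuous (wave x y w).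
Proof.
have cw : continuous (fun t : R => w * t).
  by move=> t; apply: cvgM; [exact: cvg_cst|exact: cvg_id].
move=> t; apply: cvgD; apply: cvgM; try exact: cvg_cst.
  by apply: (continuous_comp (f := fun t => w * t)); [exact: cw|exact: continuous_cos].
by apply: (continuous_comp (f := fun t => w * t)); [exact: cw|exact: continuous_sin].
Qed.

Lemma has_int_wave a b x y w : w != 0 ->
  has_int a b (wave x y w) (wave (- y / w) (x / w) w b - wave (- y / w) (x / w) w a).
Proof.
move=> w0; exists (wave (- y / w) (x / w) w) => // t.
pose l := fun t : R => w * t.
have dl : is_derive t 1 l w.
  have -> : l = w *: id by apply/funext.
  by have -> : w = w *: (1 : R) by [rewrite /GRing.scale /= mulr1];
    rewrite [in X in is_derive _ _ X]/GRing.scale /= mulr1; apply: is_deriveZ.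
have dc := is_derive1_comp (is_derive_cos (l t)) dl.
have ds := is_derive1_comp (is_derive_sin (l t)) dl.
have -> : wave (- y / w) (x / w) w = ((- y / w) *: (cos \o l)) + ((x / w) *: (sin \o l)).
  by apply/funext.
have := is_deriveD (is_deriveZ (- y / w) dc) (is_deriveZ (x / w) ds).
congr is_derive; rewrite /wave /GRing.scale /= /l.
by move: (cos _) (sin _) => C S; field.
Qed.

Lemma waveM x y x' y' w w' t : wave x y w t * wave x' y' w' t =
  2^-1 * (wave (x * x' + y * y') (y * x' - x * y') (w - w') t +
          wave (x * x' - y * y') (x * y' + y * x') (w + w') t).
Proof.
rewrite /wave (mulrBl t w w') (mulrDl w w' t) cosB cosD sinB sinD.
by field.
Qed.

Lemma sin_cos_shift3 (k : nat) (t : R) :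
  (cos (t + 2 * pi * k%:R) = cos t) * (sin (t + 2 * pi * k%:R) = sin t).
Proof.
have -> : 2 * pi * k%:R = (pi *+ 2) *+ k :> R.
  by rewrite -mulrnA -[RHS]mulr_natr natrM; ring.
by split; [have H := periodicn (@cosD2pi R)|have H := periodicn (@sinD2pi R)]; exact: H.
Qed.

Lemma wave_period (k : nat) x y t :
  wave x y (2 * pi * k%:R) (t + 1) = wave x y (2 * pi * k%:R) t.
Proof. by rewrite /wave mulrDr mulr1 !sin_cos_shift3. Qed.

Lemma waveN x y w t : wave x y (- w) t = wave x (- y) w t.
Proof. by rewrite /wave mulNr cosN sinN; ring. Qed.

(** The window from -1 to 2 consists of three full periods. It is the standing window because it
    contains every ball of radius at most 1 centred in [0, 1]. *)
Lemma has_int_wave_period (k : nat) x y : (0 < k)%N ->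
  has_int (-1) 2 (wave x y (2 * pi * k%:R)) 0.
Proof.
move=> k0; have w0 : 2 * pi * k%:R != 0 :> R.
  by rewrite !mulf_neq0// ?lt0r_neq0 ?pi_gt0 // ?ltr0n.
have := has_int_wave (-1) 2 x y w0.
suff E a b : wave a b (2 * pi * k%:R) 2 = wave a b (2 * pi * k%:R) (-1) by rewrite E subrr.
by rewrite -(wave_period k a b (-1)) -(wave_period k a b (-1 + 1))
  -(wave_period k a b (-1 + 1 + 1)); congr wave; ring.
Qed.

(** The shift by one removes the constant term: the indices below [K] are exactly the frequencies 1
    to [K], up to the factor 2 pi. *)
Definition freq (n : nat) : R := 2 * pi * n.+1%:R.

Lemma freq_gt0 n : 0 < freq n.
Proof. by rewrite /freq !mulr_gt0 ?pi_gt0. Qed.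

Definition trig (x y : nat -> R) (L : nat) (t : R) : R :=
  \sum_(n < L) wave (x n) (y n) (freq n) t.

Lemma continuous_trig x y L : continuous (trig x y L).
Proof.
elim: L => [|L IH] t.
  by rewrite /continuous_at /trig; under eq_fun do rewrite big_ord0; rewrite big_ord0; exact: cvg_cst.
rewrite /continuous_at /trig; under eq_fun do rewrite big_ord_recr.
by rewrite big_ord_recr; apply: cvgD; [exact: IH|exact: continuous_wave].
Qed.

(** Orthogonality: product-to-sum leaves waves that run through whole periods, except for the zero
    difference frequency when [n = k]. There 3/2 is the length 3 times the mean value 1/2. *)
Lemma has_int_waveM x y x' y' n k : has_int (-1) 2
  (fun t => wave x y (freq n) t * wave x' y' (freq k) t)
  (if n == k then 3 / 2 * (x * x' + y * y') else 0).
Proof.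
under eq_fun => t do rewrite waveM.
have HD a b : has_int (-1) 2 (wave a b (freq n + freq k)) 0.
  have -> : freq n + freq k = 2 * pi * (n + k).+2%:R.
    by rewrite /freq -mulrDr -natrD; congr (_ * _%:R); lia.
  exact: has_int_wave_period.
case: eqVneq => [e|nk].
  subst k; set a := x * x' + y * y'.
  have -> : 3 / 2 * a = 2^-1 * (a * (2 - (-1)) + 0) by field.
  apply/has_intZ/has_intD; last by apply: HD.
  rewrite subrr (_ : wave _ _ 0 = fun=> a); first exact: has_int_cst.
  by apply/funext => t; rewrite /wave mul0r cos0 sin0 mulr1 mulr0 addr0.
have -> : 0 = 2^-1 * (0 + 0) :> R by rewrite addr0 mulr0.
apply/has_intZ/has_intD; last by apply: HD.
(* Exchanging the two factors changes the sign of the difference frequency, which [waveN] absorbs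
   into the sine coefficient. *)
wlog kn : n k x y x' y' {HD} nk / (k < n)%N.
  move=> H; case: (ltnP k n) => kn; first by apply: H.
  have {kn}kn : (n < k)%N by rewrite ltn_neqAle nk.
  rewrite (_ : wave _ _ _ = wave (x' * x + y' * y) (y' * x - x' * y) (freq k - freq n)).
    by apply: H; rewrite // eq_sym.
  by apply/funext => t; rewrite -(opprB (freq k) (freq n)) waveN; congr wave; ring.
have -> : freq n - freq k = 2 * pi * (n - k)%:R.
  by rewrite /freq -mulrBr -natrB; [congr (_ * _%:R); lia|lia].
by apply: has_int_wave_period; lia.
Qed.

Definition energy (x y : nat -> R) (L : nat) : R :=
  \sum_(n < L) (x n ^+ 2 + y n ^+ 2).

Lemma has_int_trig_sqr x y L :
  has_int (-1) 2 (fun t => trig x y L t ^+ 2) (3 / 2 * energy x y L).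
Proof.
have -> : (fun t => trig x y L t ^+ 2) = (fun t => \sum_(n < L) \sum_(k < L)
    (wave (x n) (y n) (freq n) t * wave (x k) (y k) (freq k) t)).
  apply/funext => t; rewrite expr2 mulr_suml.
  by apply: eq_bigr => n _; rewrite mulr_sumr.
rewrite /energy mulr_sumr.
have -> : \sum_(n < L) 3 / 2 * (x n ^+ 2 + y n ^+ 2) =
   \sum_(n < L) \sum_(k < L) (if n == k :> nat then 3 / 2 * (x n * x k + y n * y k) else 0).
  apply: eq_bigr => n _; rewrite (bigD1 n) //= eqxx -!expr2 big1 ?addr0 // => k kn.
  by rewrite eq_sym; move: kn; rewrite -(inj_eq val_inj) /= => /negbTE ->.
pose f (n : nat) t := \sum_(k < L) (wave (x n) (y n) (freq n) t * wave (x k) (y k) (freq k) t).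
pose v (n : nat) := \sum_(k < L) (if n == k :> nat then 3 / 2 * (x n * x k + y n * y k) else 0).
apply: (@has_int_sum _ _ L f v) => n _.
pose f' (k : nat) t := (wave (x n) (y n) (freq n) t * wave (x k) (y k) (freq k) t).
pose v' (k : nat) := (if n == k then 3 / 2 * (x n * x k + y n * y k) else 0).
apply: (@has_int_sum _ _ L f' v') => k _.
exact: has_int_waveM.
Qed.

(** Division by zero makes the value at the origin 0 instead of the usual 1; the estimates below are
    at positive arguments. *)
Definition sinc (u : R) : R := sin u / u.

(** Integrating over a symmetric interval keeps the phase of each wave and only rescales it, so
    averaging over a ball is a Fourier multiplier. *)
Lemma has_int_trig_ball x y L t h : 0 < h ->
  has_int (t - h) (t + h) (trig x y L)
    (2 * h * trig (fun n => x n * sinc (freq n * h)) (fun n => y n * sinc (freq n * h)) L t).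
Proof.
move=> h0; rewrite /trig mulr_sumr.
apply: (@has_int_sum _ _ L (fun n => wave (x n) (y n) (freq n))
  (fun n => 2 * h * wave (x n * sinc (freq n * h)) (y n * sinc (freq n * h)) (freq n) t)).
move=> n _.
have w0 := lt0r_neq0 (freq_gt0 n).
have := has_int_wave (t - h) (t + h) (x n) (y n) w0.
congr has_int.
rewrite /wave /sinc mulrDr mulrBr cosB cosD sinB sinD.
have := lt0r_neq0 h0; move: w0.
by move=> w0 h0'; field; rewrite w0 h0'.
Qed.

End TrigPoly.

(** * Multipliers of lacunary averages *)

Section Kernel.
Context {R : realType}.

(** Geometric decay, by splitting off the first term: 1/K_0 + 2/K_1 is at most 1/K_0 + 1/K_0. *)
Lemma sum_inv_lacunary (K : nat -> nat) N : (0 < K 0%N)%N ->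
  (forall k, 2 * K k <= K k.+1)%N ->
  \sum_(k < N) (K k)%:R^-1 <= 2 / (K 0%N)%:R :> R.
Proof.
elim: N K => [|N IH] K K0 K2.
  by rewrite big_ord0 divr_ge0.
rewrite big_ord_recl /=.
have K1 : (0 < K 1%N)%N by have := K2 0%N; lia.
have := IH (fun k => K k.+1) K1 (fun k => K2 k.+1).
under [X in _ -> _ + X <= _]eq_bigr => i _ do rewrite /bump /= add1n.
move=> H; apply: le_trans (lerD (lexx _) H) _.
have := K2 0%N; rewrite -(ler_nat R) natrM => h.
have p0 : 0 < (K 0%N)%:R :> R by rewrite ltr0n.
have p1 : 0 < (K 1%N)%:R :> R by rewrite ltr0n.
have : 2 / (K 1%N)%:R <= (K 0%N)%:R^-1 :> R.
  by rewrite ler_pdivrMr// mulrC ler_pdivlMr.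
by rewrite (mulrDl 1 1) mul1r => h'; lra.
Qed.

(** Leading indices with [K k <= n] contribute nothing and are dropped one by one; from the first
    cut-off above [n] on, the geometric bound applies. *)
Lemma sum_high_lacunary (K : nat -> nat) n N : (0 < K 0%N)%N ->
  (forall k, 2 * K k <= K k.+1)%N ->
  \sum_(k < N) (if (n < K k)%N then n.+1%:R / (K k)%:R else 0) <= 2 :> R.
Proof.
elim: N K => [|N IH] K K0 K2; first by rewrite big_ord0.
case: (ltnP n (K 0%N)) => nK.
  apply: (@le_trans _ _ (n.+1%:R * \sum_(k < N.+1) (K k)%:R^-1)).
    by rewrite mulr_sumr; apply: ler_sum => i _; case: ifP => // _; exact: divr_ge0.
  apply: le_trans (ler_wpM2l _ (sum_inv_lacunary N.+1 K0 K2)) _; first by [].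
  rewrite mulrCA ger_pMr// ler_pdivrMr ?ltr0n// mul1r ler_nat; exact: nK.
rewrite big_ord_recl /= ltnNge nK /= add0r.
have K1 : (0 < K 1%N)%N by have := K2 0%N; lia.
have := IH (fun k => K k.+1) K1 (fun k => K2 k.+1).
by under [X in _ -> X <= _]eq_bigr => i _ do rewrite /bump /= add1n.
Qed.

Lemma sum_low_lacunary (K : nat -> nat) n N : (forall k, 2 * K k <= K k.+1)%N ->
  \sum_(k < N) (if (n < K k)%N then 0 else (K k)%:R / n.+1%:R) <= 2 :> R.
Proof.
move=> K2.
(* The bound by [K N] carries the induction: if [K N <= n], adding [K N] gives at most 2 K_N, which
   is below both K_(N+1) and 2n. *)
have H : (\sum_(k < N) (if (n < K k)%N then 0 else K k) <= minn (K N) (2 * n))%N.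
  elim: N => [|N IH]; first by rewrite big_ord0.
  rewrite big_ord_recr /=; move: IH (K2 N); set S := (\sum_(k < N) _)%N.
  by case: (ltnP n (K N)); lia.
have {}H : (\sum_(k < N) (if (n < K k)%N then 0 else K k) <= 2 * n.+1)%N by lia.
have -> : \sum_(k < N) (if (n < K k)%N then 0 else (K k)%:R / n.+1%:R) =
  (\sum_(k < N) (if (n < K k)%N then 0 else K k))%:R / n.+1%:R :> R.
  rewrite natr_sum mulr_suml; apply: eq_bigr => i _.
  by case: ifP => //; rewrite mul0r.
by rewrite ler_pdivrMr ?ltr0n// -natrM ler_nat.
Qed.

Lemma cos_ge_subr (u : R) : 0 <= u -> 1 - cos u <= u.
Proof.
move=> u0.
have [|c _] := @MVT_segment R cos (fun x => - sin x) 0 u u0 (fun x _ => is_derive_cos x).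
  by apply: continuous_subspaceT; exact: continuous_cos.
rewrite cos0 subr0 => H.
have : - sin c * u >= - u by rewrite mulNr lerN2 ler_piMl// sin_le1.
lra.
Qed.

(** The mean value theorem gives u - sin u = (1 - cos c) u with c in [0, u], and 1 - cos c is at
    most c. This crude order suffices for [sinc_near1]. *)
Lemma sin_sub_bound (u : R) : 0 <= u -> `|u - sin u| <= u ^+ 2.
Proof.
move=> u0.
have [|c /andP[c0 cu]] := @MVT_segment R (id - sin) (fun x => 1 - cos x) 0 u u0
    (fun x _ => is_deriveB (is_derive_id x 1) (is_derive_sin x)).
  apply: continuous_subspaceT => x; apply: cvgB; first exact: cvg_id.
    exact: continuous_sin.
rewrite !fctE sin0 !subr0 => ->.
rewrite !bnd_simp in c0 cu.
rewrite normrM (ger0_norm u0) ger0_norm ?subr_ge0 ?cos_le1// expr2.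
by rewrite ler_wpM2r//; apply: le_trans (cos_ge_subr c0) cu.
Qed.

Lemma sinc_near1 (u : R) : 0 < u -> `|1 - sinc u| <= u.
Proof.
move=> u0; have -> : 1 - sinc u = (u - sin u) / u.
  by rewrite /sinc; field; exact: lt0r_neq0.
rewrite normrM (gtr0_norm (_ : 0 < u^-1)) ?invr_gt0//.
by rewrite ler_pdivrMr// -expr2; apply: sin_sub_bound; exact: ltW.
Qed.

Lemma sinc_decay (u : R) : 0 < u -> `|sinc u| <= u^-1.
Proof.
move=> u0; rewrite /sinc normrM (gtr0_norm (_ : 0 < u^-1)) ?invr_gt0//.
by rewrite ger_pMl ?invr_gt0// sin_max.
Qed.

(** The multiplier of the sharp cut at frequency [K] minus that of the average over the ball of
    radius 1/(2 pi K). *)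
Definition cutoff_err (K n : nat) : R := (n < K)%:R - sinc (n.+1%:R / K%:R).

(** With u = (n+1)/K the error is at most u below the cut and at most 1/u above it. Both bounds are
    at most 1, so they also bound the square. *)
Lemma cutoff_err_sqr K n : (0 < K)%N -> cutoff_err K n ^+ 2 <=
  (if (n < K)%N then n.+1%:R / K%:R else 0) + (if (n < K)%N then 0 else K%:R / n.+1%:R).
Proof.
move=> K0; have p0 : 0 < K%:R :> R by rewrite ltr0n.
have u0 : 0 < n.+1%:R / K%:R :> R by rewrite divr_gt0.
have sq (z v : R) : `|z| <= v -> v <= 1 -> z ^+ 2 <= v.
  move=> zv v1; rewrite -real_normK ?num_real//; apply: (le_trans _ zv).
  by rewrite expr2 ler_piMl// (le_trans zv v1).
rewrite /cutoff_err; case: (ltnP n K) => nK.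
  rewrite addr0; apply: sq; first exact: sinc_near1.
  by rewrite ler_pdivrMr// mul1r ler_nat.
rewrite sub0r add0r; apply: sq; last by rewrite ler_pdivrMr// mul1r ler_nat; lia.
by rewrite normrN -[leRHS]invf_div; exact: sinc_decay.
Qed.

(** The bound is uniform in the frequency, so summing over cut-offs first controls the total energy
    of all errors by that of the series. *)
Lemma sum_cutoff_err_sqr (K : nat -> nat) n N : (0 < K 0%N)%N ->
  (forall k, 2 * K k <= K k.+1)%N ->
  \sum_(k < N) cutoff_err (K k) n ^+ 2 <= 4.
Proof.
move=> K0 K2.
have Kp k : (0 < K k)%N by elim: k => // k; have := K2 k; lia.
apply: le_trans (_ : _ <= 2 + 2) _; last lra.
apply: le_trans (lerD (sum_high_lacunary n N K0 K2) (sum_low_lacunary n N K2)).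
by rewrite -big_split /=; apply: ler_sum => k _; exact: cutoff_err_sqr.
Qed.

End Kernel.

(** * Kolmogorov's theorem on lacunary partial sums *)

Section Maximal.
Context {R : realType}.
Local Notation mu := (@lebesgue_measure R).
Local Notation I12 := (`[(-1)%R, 2%R]%classic : set R).

Lemma continuous_integrable_itv (a b : R) (f : R -> R) : continuous f ->
  mu.-integrable `[a, b] (EFin \o f).
Proof.
move=> cf; apply: continuous_compact_integrable; first exact: segment_compact.
exact: continuous_subspaceT.
Qed.

Lemma continuous_measurable_EFin (D : set R) (f : R -> R) : continuous f ->
  measurable_fun D (fun t => (f t)%:E).
Proof.
move=> cf; apply: measurable_funTS; apply/measurable_EFinP.
exact: continuous_measurable_fun.
Qed.

(** Restricting [g] to the window makes it integrable on the line, and does not alter the average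
    because the ball lies inside the window. *)
Lemma normr_avg_le_HL (g : R -> R) (t h v : R) : continuous g ->
  0 < h -> -1 <= t - h -> t + h <= 2 -> has_int (t - h) (t + h) g (2 * h * v) ->
  (`|v|%:E <= HL_maximal (g \_ I12) t)%E.
Proof.
move=> cg h0 lo hi ig.
apply: (@le_trans _ _ (iavg (g \_ I12) (ball t h))); last first.
  by apply: ereal_sup_ubound; exists h => //=; rewrite in_itv/= h0.
rewrite iavg_restrict//; last exact: measurable_ball.
have -> : I12 `&` ball t h = ball t h.
  apply/setIidPr; rewrite ball_itv => x /=; rewrite !in_itv/= => /andP[h1 h2].
  by apply/andP; split; apply: ltW; [apply: le_lt_trans h1|apply: lt_le_trans hi].
rewrite lebesgue_measure_ball; last exact: ltW.
have tt : t - h < t + h by lra.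
have H : (`|2 * h * v|%:E <= \int[mu]_(y in ball t h) `|g y|%:E)%E.
  rewrite -abse_EFin -(has_int_integral tt cg ig).
  rewrite integral_itv_bndoo; last exact: continuous_measurable_EFin.
  rewrite ball_itv; apply: le_abse_integral => //.
  exact: continuous_measurable_EFin.
have -> : `|v|%:E = ((h *+ 2)%:E^-1 * `|2 * h * v|%:E)%E.
  rewrite inver mulrn_eq0 /= (gt_eqF h0) -EFinM; congr EFin.
  rewrite -(mulr_natl h 2) normrM (gtr0_norm (_ : 0 < 2 * h)) ?mulr_gt0//.
  by field; exact: lt0r_neq0.
apply: lee_wpmul2l => //.
by rewrite inver mulrn_eq0 /= (gt_eqF h0) lee_fin invr_ge0 mulrn_wge0// ltW.
Qed.

Lemma locally_integrable_restrict (a b : R) (g : R -> R) : continuous g ->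
  locally_integrable setT (g \_ `[a, b]).
Proof.
move=> cg; apply: open_integrable_locally; first exact: openT.
rewrite -restrict_EFin.
have [H _] := @integrable_mkcond _ _ _ mu `[a, b] (EFin \o g) (measurable_itv _).
by apply: H; exact: continuous_integrable_itv.
Qed.

(** The weak-type maximal inequality has constant 3, and the L^1 norm on the window is at most 3
    delta. The latter follows by integrating |g| <= delta/2 + g^2/(2 delta), which replaces
    Cauchy-Schwarz. *)
Lemma measure_HL_trig (x y : nat -> R) L (lambda delta : R) :
  0 < lambda -> 0 < delta -> energy x y L <= delta ^+ 2 ->
  (mu [set t | lambda%:E < HL_maximal (trig x y L \_ I12) t] <= (9 * delta / lambda)%:E)%E.
Proof.
move=> l0 d0 Ed; set g := trig x y L.
have cg : continuous g by exact: continuous_trig.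
apply: le_trans (maximal_inequality _ l0) _.
  exact: locally_integrable_restrict.
have -> : (9 * delta / lambda)%:E = ((3 / lambda)%:E * (3 * delta)%:E)%E.
  by rewrite -EFinM; congr EFin; field; exact: lt0r_neq0.
apply: lee_wpmul2l; first by rewrite lee_fin divr_ge0// ltW.
rewrite (_ : (\int[mu]_(y in setT) _ = \int[mu]_(y in I12) `|g y|%:E)%E); last first.
  rewrite [RHS]integral_mkcond; apply: eq_integral => t _.
  by rewrite !patchE; case: ifP => // _; rewrite /= normr0.
have H : has_int (-1) 2 (fun t => delta / 2 + (2 * delta)^-1 * g t ^+ 2)
    (delta / 2 * (2 - -1) + (2 * delta)^-1 * (3 / 2 * energy x y L)).
  by apply: has_intD; [exact: has_int_cst|apply: has_intZ; exact: has_int_trig_sqr].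
have cH : continuous (fun t => delta / 2 + (2 * delta)^-1 * g t ^+ 2).
  move=> t; apply: cvgD; first exact: cvg_cst.
  apply: cvgM; first exact: cvg_cst.
  by rewrite expr2; under eq_fun do rewrite expr2; apply: cvgM; exact: cg.
have ab : (-1 : R) < 2 by lra.
have I := has_int_integral ab cH H.
apply: (@le_trans _ _ (\int[mu]_(t in I12) (delta / 2 + (2 * delta)^-1 * g t ^+ 2)%:E)%E).
  apply: ge0_le_integral => //.
  - by apply: continuous_measurable_EFin => t; apply: cvg_norm; exact: cg.
  - exact: continuous_measurable_EFin.
  move=> t _; rewrite lee_fin.
  rewrite -[g t ^+ 2]real_normK ?num_real// -subr_ge0.
  have -> : delta / 2 + (2 * delta)^-1 * `|g t| ^+ 2 - `|g t| =
    (2 * delta)^-1 * (delta - `|g t|) ^+ 2 by field; exact: lt0r_neq0.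
  by rewrite mulr_ge0 ?sqr_ge0// invr_ge0 mulr_ge0// ltW.
rewrite I lee_fin.
have : (2 * delta)^-1 * energy x y L <= delta / 2.
  rewrite invfM mulrC -ler_pdivlMr ?mulr_gt0 ?invr_gt0//.
  rewrite invfM !invrK; have -> : delta / 2 * (2 * delta) = delta ^+ 2 by field.
  by [].
set e := (2 * delta)^-1 * _; have -> : (2 * delta)^-1 * (3 / 2 * energy x y L) = 3 / 2 * e.
  by rewrite /e mulrCA.
by move=> ?; lra.
Qed.

Definition lowpass (x : nat -> R) (K n : nat) : R := x n * (n < K)%:R.
Definition averaged (x : nat -> R) (K n : nat) : R := x n * sinc (n.+1%:R / K%:R).
Definition err (x : nat -> R) (K n : nat) : R := x n * cutoff_err K n.

Lemma trig_lowpass_decomp x y K L t :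
  trig (lowpass x K) (lowpass y K) L t =
  trig (averaged x K) (averaged y K) L t + trig (err x K) (err y K) L t.
Proof.
rewrite /trig -big_split /=; apply: eq_bigr => n _.
by rewrite /wave /lowpass /averaged /err /cutoff_err; ring.
Qed.

Lemma trig_averaged_le_HL (x y : nat -> R) (K L : nat) (t : R) :
  (0 < K)%N -> 0 <= t <= 1 ->
  (`|trig (averaged x K) (averaged y K) L t|%:E <= HL_maximal (trig x y L \_ I12) t)%E.
Proof.
(* This radius turns [freq n * h] into (n+1)/K; being at most 1, it keeps the ball in the window. *)
move=> K0 /andP[t0 t1]; pose h : R := (2 * pi * K%:R)^-1.
have p0 : 1 <= K%:R :> R by rewrite ler1n.
have d1 : 1 <= 2 * pi * K%:R :> R.
  have := pi_ge2 R => pi2; rewrite -[leLHS]mulr1; apply: ler_pM => //; lra.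
have d0 := lt_le_trans ltr01 d1.
have h0 : 0 < h by rewrite invr_gt0.
have h1 : h <= 1 by rewrite invf_le1.
apply: (@normr_avg_le_HL _ _ h) => //; first exact: continuous_trig.
- lra.
- lra.
have := has_int_trig_ball x y L t h0.
congr has_int; congr (_ * _); apply: eq_bigr => n _.
have -> : freq n * h = n.+1%:R / K%:R.
  rewrite /freq /h; have := lt0r_neq0 (pi_gt0 R).
  have : K%:R != 0 :> R by rewrite lt0r_neq0// ltr0n.
  by move: (K%:R) (pi) => a b a0 b0; field; rewrite a0 b0.
by [].
Qed.

Lemma continuous_sum_sqr_trig (x y : nat -> nat -> R) L N :
  continuous (fun t => \sum_(k < N) trig (x k) (y k) L t ^+ 2).
Proof.
elim: N => [|N IH] t.
  by rewrite /continuous_at; under eq_fun do rewrite big_ord0; rewrite big_ord0; exact: cvg_cst.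
rewrite /continuous_at; under eq_fun do rewrite big_ord_recr.
rewrite big_ord_recr; apply: cvgD; first exact: IH.
by rewrite expr2; under eq_fun do rewrite expr2; apply: cvgM; exact: continuous_trig.
Qed.

Lemma measurable_exceed (x y : nat -> nat -> R) L N (c : R) :
  measurable [set t : R | exists2 k, (k < N)%N & c < `|trig (x k) (y k) L t|].
Proof.
rewrite (_ : [set t | _] = \bigcup_(k in [set k | (k < N)%N])
    [set t | c < `|trig (x k) (y k) L t|]); last first.
  by apply/seteqP; split => t /= [k kN kt]; exists k.
apply: bigcup_measurable => k _; apply: open_measurable.
apply: (open_comp (f := fun t => `|trig (x k) (y k) L t|) (D := [set z | c < z])).
  by move=> t _; apply: cvg_norm; exact: continuous_trig.
exact: open_gt.
Qed.

Lemma sum_energy_err (x y : nat -> R) (K : nat -> nat) L N : (0 < K 0%N)%N ->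
  (forall k, 2 * K k <= K k.+1)%N ->
  \sum_(k < N) energy (err x (K k)) (err y (K k)) L <= 4 * energy x y L.
Proof.
move=> K0 K2; rewrite /energy exchange_big /= mulr_sumr; apply: ler_sum => n _.
have -> : \sum_(k < N) (err x (K k) n ^+ 2 + err y (K k) n ^+ 2) =
  (\sum_(k < N) cutoff_err (K k) n ^+ 2) * (x n ^+ 2 + y n ^+ 2).
  by rewrite mulr_suml; apply: eq_bigr => k _; rewrite /err; ring.
by apply: ler_wpM2r; [rewrite addr_ge0 ?sqr_ge0|exact: sum_cutoff_err_sqr].
Qed.

(** Markov's inequality for the square function of the errors; the constant 6 is 3/2 from Parseval
    times 4 from [sum_energy_err]. *)
Lemma measure_sum_sqr_err (x y : nat -> R) (K : nat -> nat) L N lambda :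
  0 < lambda -> (0 < K 0%N)%N -> (forall k, 2 * K k <= K k.+1)%N ->
  (mu (I12 `&` [set t | (lambda ^+ 2 <=
     \sum_(k < N) trig (err x (K k)) (err y (K k)) L t ^+ 2)%R])
   <= (6 * energy x y L / lambda ^+ 2)%:E)%E.
Proof.
move=> l0 K0 K2; pose S t := \sum_(k < N) trig (err x (K k)) (err y (K k)) L t ^+ 2.
rewrite (_ : [set t | _] = [set t | lambda ^+ 2 <= S t])//.
have l20 : 0 < lambda ^+ 2 by rewrite exprn_gt0.
have iS : has_int (-1) 2 S (\sum_(k < N) 3 / 2 * energy (err x (K k)) (err y (K k)) L).
  apply: (@has_int_sum _ _ _ N (fun k t => trig (err x (K k)) (err y (K k)) L t ^+ 2)
    (fun k => 3 / 2 * energy (err x (K k)) (err y (K k)) L)) => k _.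
  exact: has_int_trig_sqr.
have cS : continuous S := @continuous_sum_sqr_trig (fun k => err x (K k)) (fun k => err y (K k)) L N.
have S0 t : 0 <= S t by apply: sumr_ge0 => k _; exact: sqr_ge0.
have ab : (-1 : R) < 2 by lra.
have I := has_int_integral ab cS iS.
have := @le_integral_comp_abse _ _ R mu I12 (measurable_itv _) (EFin \o S)
   (lambda ^+ 2) id (@measurable_id _ _ _) (fun r r0 => r0) (fun x y _ _ xy => xy)
   (continuous_measurable_EFin cS) l20.
under eq_integral do rewrite /= ger0_norm//.
rewrite I => H.
have -> : [set t | lambda ^+ 2 <= S t] = [set t | ((lambda ^+ 2)%:E <= `|(EFin \o S) t|)%E].
  by apply/seteqP; split => t /=; rewrite lee_fin ger0_norm.
rewrite -(@lee_pmul2l _ (lambda ^+ 2)%:E) ?lte_fin//.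
apply: le_trans H _; rewrite -EFinM lee_fin.
have -> : lambda ^+ 2 * (6 * energy x y L / lambda ^+ 2) = 3 / 2 * (4 * energy x y L).
  by field; exact: lt0r_neq0.
rewrite -mulr_sumr; apply: ler_wpM2l; first lra.
exact: sum_energy_err.
Qed.

(** If a cut sum exceeds 2 lambda, either its average exceeds lambda, hence so does the maximal
    function, or its error is at least lambda, hence the square function is at least lambda^2. The
    bound depends neither on [L] nor on [N]. *)
Lemma lacunary_maximal_inequality (x y : nat -> R) (K : nat -> nat) L N (lambda delta : R) :
  0 < lambda -> 0 < delta -> (0 < K 0%N)%N -> (forall k, 2 * K k <= K k.+1)%N ->
  energy x y L <= delta ^+ 2 ->
  (mu (`[0%R, 1%R[ `&` [set t | exists2 k, (k < N)%N &
     (2 * lambda < `|trig (lowpass x (K k)) (lowpass y (K k)) L t|)%R])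
   <= (9 * delta / lambda + 6 * delta ^+ 2 / lambda ^+ 2)%:E)%E.
Proof.
move=> l0 d0 K0 K2 Ed.
have Kp k : (0 < K k)%N by elim: k => // k; have := K2 k; lia.
have l20 : 0 < lambda ^+ 2 by rewrite exprn_gt0.
pose S t := \sum_(k < N) trig (err x (K k)) (err y (K k)) L t ^+ 2.
set A := [set t | lambda%:E < HL_maximal (trig x y L \_ I12) t]%E.
set B := I12 `&` [set t | (lambda ^+ 2 <= S t)%R].
have sub : `[0%R, 1%R[ `&` [set t | exists2 k, (k < N)%N &
     (2 * lambda < `|trig (lowpass x (K k)) (lowpass y (K k)) L t|)%R] `<=` A `|` B.
  move=> t [/=]; rewrite in_itv /= => /andP[t0 t1] [k kN].
  rewrite trig_lowpass_decomp => big.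
  have [sm|sm] := ltP lambda `|trig (averaged x (K k)) (averaged y (K k)) L t|.
    left; rewrite /A /=; apply: lt_le_trans (trig_averaged_le_HL x y L (Kp k) _).
      by rewrite lte_fin.
    by rewrite t0 ltW.
  right; split; first by rewrite /= in_itv /=; apply/andP; split; lra.
  have er : lambda <= `|trig (err x (K k)) (err y (K k)) L t|.
    have := ler_normD (trig (averaged x (K k)) (averaged y (K k)) L t) (trig (err x (K k)) (err y (K k)) L t).
    lra.
  rewrite /= /S (bigD1 (Ordinal kN)) //=.
  rewrite -[leLHS]addr0 lerD ?sumr_ge0//.
    by rewrite -[leRHS]real_normK ?num_real// lerXn2r// ?nnegrE ?normr_ge0// ltW.
  by move=> i _; exact: sqr_ge0.
have mA : measurable A.
  rewrite /A -[X in measurable X]setTI; apply: emeasurable_fun_o_infty => //.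
  by apply: measurable_HL_maximal; apply: locally_integrable_restrict; exact: continuous_trig.
have mB : measurable B.
  apply: measurableI => //.
  apply: closed_measurable; apply: (closed_comp (f := S) (D := [set z | lambda ^+ 2 <= z])).
    by move=> t _; exact: (@continuous_sum_sqr_trig (fun k => err x (K k)) (fun k => err y (K k)) L N).
  exact: closed_ge.
apply: (@le_trans _ _ (mu (A `|` B))).
  apply: le_measure => //; rewrite inE; last exact: measurableU.
  apply: measurableI => //.
  exact: (@measurable_exceed (fun k => lowpass x (K k)) (fun k => lowpass y (K k))).
have U := @measureU2 _ _ _ mu A B mA mB.
apply: (le_trans U).
rewrite EFinD; apply: leeD; first exact: measure_HL_trig.
apply: le_trans (measure_sum_sqr_err x y L N l0 K0 K2) _.
rewrite lee_fin; apply: ler_wpM2r; first by rewrite invr_ge0 ltW.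
by rewrite ler_pM2l.
Qed.

End Maximal.

(** * From the maximal inequality to almost everywhere convergence *)

Section Kolmogorov.
Context {R : realType}.
Local Notation mu := (@lebesgue_measure R).

Lemma negligible_small (A : set R) :
  (forall eta : R, 0 < eta -> exists V : set R,
     [/\ measurable V, A `<=` V & (mu V <= eta%:E)%E]) -> mu.-negligible A.
Proof.
move=> H.
have /choice[V HV] : forall n : nat, exists V : set R,
    [/\ measurable V, A `<=` V & (mu V <= (n.+1%:R^-1)%:E)%E].
  by move=> n; apply: H; rewrite invr_gt0.
exists (\bigcap_n V n); split.
- by apply: bigcap_measurable => // n _; have [] := HV n.
- apply/eqP; rewrite eq_le measure_ge0 andbT.
  apply/lee_addgt0Pr => e e0; rewrite add0e.
  have [n ne] : exists n : nat, n.+1%:R^-1 < e.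
    have [n _ hn] := near_infty_natSinv_lt (PosNum e0).
    by exists n; exact: (hn n (leqnn n)).
  have [mV _ Vn] := HV n.
  apply: (@le_trans _ _ (mu (V n))).
    apply: le_measure => //; rewrite ?inE//.
      by apply: bigcap_measurable => // k _; have [] := HV k.
    exact: bigcap_inf.
  by apply: (le_trans Vn); rewrite lee_fin ltW.
- by move=> t At n _; have [_ + _] := HV n; exact.
Qed.

Lemma measure_bigcup_le (V : nat -> set R) (c : \bar R) :
  (forall n, measurable (V n)) -> nondecreasing_seq V ->
  (forall n, mu (V n) <= c)%E -> (mu (\bigcup_n V n) <= c)%E.
Proof.
move=> mV ndV Vc.
have C : (mu \o V) @ \oo --> mu (\bigcup_n V n).
  by apply: nondecreasing_cvg_mu => //; exact: bigcupT_measurable.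
rewrite -(cvg_lim _ C)//; apply: lime_le; first by apply/cvg_ex; exists (mu (\bigcup_n V n)).
by apply: nearW => n; exact: Vc.
Qed.

Lemma energy_tail (x y : nat -> R) (M : R) (delta : R) :
  (forall L, energy x y L <= M) -> 0 < delta ->
  exists p, forall L, energy x y L - energy x y p <= delta.
Proof.
move=> EM d0; pose S := range (energy x y).
have hS : has_sup S.
  split; first by exists (energy x y 0), 0%N.
  by exists M => _ [L _ <-].
have [_ [p _ <-] hp] := sup_adherent d0 hS.
exists p => L.
have : energy x y L <= sup S by apply: sup_upper_bound => //; exists L.
lra.
Qed.

Definition highpass (x : nat -> R) (p n : nat) : R := x n * (p <= n)%:R.

Lemma energy_highpass (x y : nat -> R) p L : (p <= L)%N ->
  energy (highpass x p) (highpass y p) L = energy x y L - energy x y p.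
Proof.
move=> pL; rewrite /energy -!(big_mkord xpredT (fun n => _ n ^+ 2 + _ n ^+ 2)).
rewrite (@big_cat_nat _ _ _ p 0 L) //= [in RHS](@big_cat_nat _ _ _ p 0 L)//=.
rewrite [X in X + _]big_nat big1 => [|n /andP[_ np]].
  rewrite add0r [X in _ = X - _]addrC addrK !big_nat.
  by apply: eq_bigr => n /andP[pn _]; rewrite /highpass pn !mulr1.
by rewrite /highpass leqNgt np /= !mulr0 expr0n addr0.
Qed.

(** Writes a difference of partial sums as a sharp cut of the tail series, so that the maximal
    inequality applies with the small energy of the tail. *)
Lemma trig_highpass_lowpass (x y : nat -> R) p K L t : (p <= K)%N -> (K <= L)%N ->
  trig (lowpass (highpass x p) K) (lowpass (highpass y p) K) L t = trig x y K t - trig x y p t.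
Proof.
move=> pK KL; have pL := leq_trans pK KL.
rewrite /trig -!(big_mkord xpredT (fun n => wave (_ n) (_ n) (freq n) t)).
have w0 w : wave 0 0 w t = 0 by rewrite /wave !mul0r addr0.
rewrite (@big_cat_nat _ _ _ K 0 L) //= [X in _ + X]big_nat [X in _ + X]big1; last first.
  by move=> n /andP[Kn _]; rewrite /lowpass ltnNge Kn /= !mulr0 w0.
rewrite addr0 (@big_cat_nat _ _ _ p 0 K) //= [in RHS](@big_cat_nat _ _ _ p 0 K)//=.
rewrite [X in X + _]big_nat big1 => [|n /andP[_ np]].
  rewrite add0r [X in _ = X - _]addrC addrK !big_nat.
  by apply: eq_bigr => n /andP[pn nK]; rewrite /lowpass /highpass pn nK !mulr1.
by rewrite /lowpass /highpass [(p <= n)%N]leqNgt np /= !mulr0 !mul0r w0.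
Qed.

(** Oscillation after every [p] implies oscillation after one fixed [p0]. Choosing [p0] with a tail
    of small energy makes the measure of that larger set as small as desired. *)
Lemma lacunary_not_cauchy_negligible (x y : nat -> R) (K : nat -> nat) (M eps : R) :
  0 < eps -> (0 < K 0%N)%N -> (forall k, 2 * K k <= K k.+1)%N ->
  (forall L, energy x y L <= M) ->
  mu.-negligible (`[0, 1[ `&` [set t | forall p, exists2 k, (p <= k)%N &
     eps < `|trig x y (K k) t - trig x y (K p) t|]).
Proof.
move=> e0 K0 K2 EM; apply: negligible_small => eta eta0.
have Kmono p k : (p <= k)%N -> (K p <= K k)%N.
  by apply: (homo_leq (r := leq)) => // [? ? ?|i]; [exact: leq_trans|have := K2 i; lia].
have Kp p : (0 < K p)%N by apply: leq_trans (Kmono 0%N p _).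
have Kge p : (p <= K p)%N.
  by elim: p => // p IH; have := K2 p; have := Kp p; lia.
pose lambda := eps / 2.
have l0 : 0 < lambda by rewrite divr_gt0.
have [delta [d0 dle]] : exists delta : R, 0 < delta /\
   9 * delta / lambda + 6 * delta ^+ 2 / lambda ^+ 2 <= eta.
  (* With delta = lambda m / 9 the maximal bound becomes m + (6/81) m^2; since m is at most 1 and at
     most eta/2, this stays below eta. *)
  pose m := Num.min (eta / 2) 1.
  exists (lambda * m / 9).
  have m0 : 0 < m by rewrite lt_min divr_gt0//=.
  split; first by rewrite divr_gt0// mulr_gt0.
  have -> : 9 * (lambda * m / 9) / lambda + 6 * (lambda * m / 9) ^+ 2 / lambda ^+ 2 =
     m + 6 / 81 * (m * m) by field; exact: lt0r_neq0.
  have m1 : m <= 1 by rewrite ge_min lexx orbT.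
  have m2 : m <= eta / 2 by rewrite ge_min lexx.
  have mm : m * m <= m by rewrite ger_pMr.
  lra.
have [p0 hp0] := energy_tail EM (exprn_gt0 2 d0).
pose V N := `[0, 1[ `&` [set t | exists2 k, (k < N)%N & 2 * lambda <
   `|trig (lowpass (highpass x (K p0)) (K (p0 + k)%N)) (lowpass (highpass y (K p0)) (K (p0 + k)%N))
       (K (p0 + N)%N) t|].
have VE N : V N = `[0, 1[ `&` [set t | exists2 k, (k < N)%N & eps <
    `|trig x y (K (p0 + k)%N) t - trig x y (K p0) t|].
  have -> : eps = 2 * lambda by rewrite /lambda; field.
  by apply/seteqP; split => t [? /= [k kN]] h; split => //; exists k => //; move: h;
    rewrite trig_highpass_lowpass// Kmono//; lia.
exists (\bigcup_N V N); split.
- apply: bigcup_measurable => N _; apply: measurableI => //.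
  exact: (@measurable_exceed _ (fun k => lowpass (highpass x (K p0)) (K (p0 + k)%N))
     (fun k => lowpass (highpass y (K p0)) (K (p0 + k)%N))).
- move=> t [t01 /(_ p0)[k pk h]]; exists (k - p0).+1 => //; rewrite VE; split => //=.
  by exists (k - p0)%N => //; rewrite subnKC.
apply: measure_bigcup_le.
- move=> N; apply: measurableI => //.
  exact: (@measurable_exceed _ (fun k => lowpass (highpass x (K p0)) (K (p0 + k)%N))
     (fun k => lowpass (highpass y (K p0)) (K (p0 + k)%N))).
- move=> N N' NN'; apply/subsetPset; rewrite !VE => t [t01 /= [k kN h]]; split => //=.
  by exists k => //; exact: leq_trans NN'.
move=> N; apply: le_trans (_ : (_ <= (9 * delta / lambda + 6 * delta ^+ 2 / lambda ^+ 2)%:E)%E) _.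
  apply: (@lacunary_maximal_inequality _ _ _ (fun k => K (p0 + k)%N)) => //.
    by move=> k; rewrite addnS.
  rewrite energy_highpass ?Kmono ?leq_addr//.
  (* The tail was chosen from index [p0], while the cut is at [K p0 >= p0], which leaves even less
     energy. *)
  have h1 := hp0 (K (p0 + N)%N).
  have h2 : energy x y p0 <= energy x y (K p0).
    rewrite -subr_ge0 -energy_highpass//; apply: sumr_ge0 => i _.
    by rewrite addr_ge0// sqr_ge0.
  lra.
by rewrite lee_fin.
Qed.

(** By completeness, divergence means failing the Cauchy condition for some tolerance 1/(n+1), so
    the bad set lies in a countable union of null sets. *)
Theorem kolmogorov_lacunary (x y : nat -> R) (K : nat -> nat) (M : R) :
  (0 < K 0%N)%N -> (forall k, 2 * K k <= K k.+1)%N ->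
  (forall L, energy x y L <= M) ->
  mu.-negligible (`[0, 1[ `&` ~` [set t | cvgn (fun k => trig x y (K k) t)]).
Proof.
move=> K0 K2 EM.
pose B (n : nat) := `[0, 1[ `&` [set t | forall p, exists2 k, (p <= k)%N &
     n.+1%:R^-1 < `|trig x y (K k) t - trig x y (K p) t|].
have NB : mu.-negligible (\bigcup_n B n).
  apply: negligible_bigcup => n.
  by apply: lacunary_not_cauchy_negligible EM => //; rewrite invr_gt0.
apply: negligibleS NB.
move=> t [t01 /= ncv]; apply: contrapT => nB; apply: ncv.
apply: cauchy_cvg; apply: cauchy_exP => e e0.
have [n ne] : exists n : nat, n.+1%:R^-1 < e.
  have [n _ hn] := near_infty_natSinv_lt (PosNum e0).
  by exists n; exact: (hn n (leqnn n)).
have : ~ B n t by move=> Bnt; apply: nB; exists n.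
move=> /not_andP[//|/= /existsNP[p hp]].
exists (trig x y (K p) t); exists p => // k /= pk.
rewrite -ball_normE /= distrC; apply: le_lt_trans ne.
by rewrite leNgt; apply/negP => h; apply: hp; exists k.
Qed.

End Kolmogorov.

(** * Fourier coefficients of the normalised products *)

Section Recursion.
Context {R : realType}.
Local Notation C := (R[i]).

Lemma expiD (x y : R) : expi (x + y) = expi x * expi y.
Proof. by rewrite /expi cosD sinD [sin x * _ + _]addrC. Qed.

Lemma conj_expi (x : R) : conjc (expi x) = expi (- x).
Proof. by rewrite /expi cosN sinN. Qed.

Lemma expi0 : expi (0 : R) = 1.
Proof. by rewrite /expi cos0 sin0. Qed.

Lemma expi_conjM (x : R) : expi x * conjc (expi x) = 1.
Proof. by rewrite conj_expi -expiD subrr expi0. Qed.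

(** The squared modulus as a real polynomial in the two parts, which avoids the square root in
    [normc] and lets [ring] prove identities. *)
Definition nsq (z : C) : R := complex.Re z ^+ 2 + complex.Im z ^+ 2.

Lemma normc_sqr (z : C) : normc z ^+ 2 = nsq z.
Proof.
case: z => a b; rewrite /nsq /normc /= sqr_sqrtr// addr_ge0// sqr_ge0 //.
Qed.

Lemma nsqM (z w : C) : nsq (z * w) = nsq z * nsq w.
Proof. by case: z w => [a b] [c d]; rewrite /nsq /=; ring. Qed.

Lemma nsq_conj (z : C) : nsq (conjc z) = nsq z.
Proof. by case: z => [a b]; rewrite /nsq /= sqrrN. Qed.

Lemma nsq0 : nsq 0 = 0. Proof. by rewrite /nsq /= expr0n addr0. Qed.

Lemma nsq_ge0 z : 0 <= nsq z. Proof. by rewrite addr_ge0 ?sqr_ge0. Qed.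

(** The power z^n of z = e^{2 pi i t}. *)
Definition char (n : nat) (t : R) : C := expi (2 * pi * n%:R * t).

Lemma charD m n t : char (m + n) t = char m t * char n t.
Proof. by rewrite /char -expiD natrD; congr expi; ring. Qed.

Lemma char_conjM n t : char n t * conjc (char n t) = 1.
Proof. exact: expi_conjM. Qed.

Lemma charS_conj n t : char n.+1 t * conjc (char 1 t) = char n t.
Proof. by rewrite -[n.+1]addn1 charD -mulrA char_conjM mulr1. Qed.

Lemma char_sub m n t : (n <= m)%N -> char (m - n) t = char m t * conjc (char n t).
Proof.
move=> nm; rewrite -{2}(subnK nm) charD -mulrA char_conjM mulr1.
by [].
Qed.

(* Used with g_j = +-B_j / A_j; it starts at z itself, so that the coefficient of
   z^{n+1} is the n-th one below. *)
Fixpoint lac_orbit (g : nat -> C) (m : nat -> nat) (N : nat) (t : R) : C :=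
  if N is k.+1 then lac_orbit g m k t + g k * char (m k).+1 t * conjc (lac_orbit g m k t)
  else char 1 t.

Lemma lac_orbitS g m N t : lac_orbit g m N.+1 t =
  lac_orbit g m N t + g N * char (m N).+1 t * conjc (lac_orbit g m N t).
Proof. by []. Qed.

Section Coefficients.
Context (g : nat -> C) (m : nat -> nat).
Context (m0 : (0 < m 0%N)%N) (m2 : forall k, (2 * m k <= m k.+1)%N).

(** The coefficient of z^(n+1) in [lac_orbit] at step k+1. Multiplying a conjugate by z^(m+1)
    reflects index n to m - (n+1); the guard keeps truncated subtraction from sending large n to
    index 0. *)
Fixpoint coef (k n : nat) : C :=
  if k is j.+1 then
    coef j n + (if (n < m j.+1)%N then g j.+1 * conjc (coef j (m j.+1 - n.+1)) else 0)
  else (n == 0%N)%:R + g 0%N * (n.+1 == m 0%N)%:R.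

Lemma lacunary_gt k : (k < m k)%N.
Proof. by elim: k => // k IH; have := m2 k; lia. Qed.

Lemma lacunary_homo j k : (j <= k)%N -> (m j <= m k)%N.
Proof.
by apply: (homo_leq (r := leq)) => // [? ? ?|i]; [exact: leq_trans|have := m2 i; lia].
Qed.

Lemma coef_out k n : (m k <= n)%N -> coef k n = 0.
Proof.
elim: k n => [|k IH] n kn /=.
  by rewrite !gtn_eqF//= ?mulr0 ?addr0//; lia.
by rewrite IH ?ltnNge ?kn ?addr0//; have := m2 k; lia.
Qed.

(** The reflected block of step k+1 starts at index m_(k+1) - m_k, which is at least m_k by
    lacunarity, so it never touches the coefficients already present. *)
Lemma coef_stable j k n : (j <= k)%N -> (n < m j)%N -> coef k n = coef j n.
Proof.
move=> jk nj; elim: k jk => [|k IH]; first by rewrite leqn0 => /eqP ->.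
rewrite leq_eqVlt => /orP[/eqP -> //|jk].
rewrite -IH//= (@coef_out k (_ - _)) ?conjc0 ?mulr0 ?if_same ?addr0//.
by have := m2 k; have := lacunary_homo (jk : (j <= k)%N); lia.
Qed.

Lemma sum_coef_extend (F : nat -> C -> C) k L : (m k <= L)%N -> (forall n, F n 0 = 0) ->
  \sum_(n < L) F n (coef k n) = \sum_(n < m k) F n (coef k n).
Proof.
move=> kL F0; rewrite -!(big_mkord xpredT (fun n => F n (coef k n))).
rewrite (@big_cat_nat _ _ _ (m k) 0 L) //= [X in _ + X]big_nat [X in _ + X]big1 ?addr0//.
by move=> n /andP[kn _]; rewrite coef_out.
Qed.

Lemma lac_orbit_coef k t : lac_orbit g m k.+1 t = \sum_(n < m k) coef k n * char n.+1 t.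
Proof.
elim: k => [|k IH].
  rewrite [LHS]/= -mulrA charS_conj.
  under eq_bigr do rewrite /= mulrDl.
  rewrite big_split /=; congr (_ + _).
    rewrite (bigD1 (Ordinal m0)) //= mul1r big1 ?addr0// => n.
    by rewrite -(inj_eq val_inj) /= => /negbTE ->; rewrite mul0r.
  have mp : ((m 0%N).-1 < m 0%N)%N by lia.
  rewrite (bigD1 (Ordinal mp)) //= prednK// eqxx mulr1 big1 ?addr0// => n.
  rewrite -(inj_eq val_inj) /= => nE; have /negbTE -> : n.+1 != m 0%N by lia.
  by rewrite mulr0 mul0r.
rewrite lac_orbitS IH; set S := \sum_(n < m k) _.
under [RHS]eq_bigr => n _ do rewrite /= ltn_ord mulrDl.
rewrite big_split /=; congr (_ + _).
  rewrite /S (@sum_coef_extend (fun n z => z * char n.+1 t) k (m k.+1))//.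
    by have := m2 k; lia.
  by move=> n; rewrite mul0r.
(* Reversing the order of summation undoes the reflection of exponents caused by conjugation. *)
rewrite (reindex_inj rev_ord_inj) /=.
rewrite /S -(@sum_coef_extend (fun n z => z * char n.+1 t) k (m k.+1)); first last.
- by move=> n; rewrite mul0r.
- by have := m2 k; lia.
rewrite rmorph_sum mulr_sumr; apply: eq_bigr => n _.
have nm := ltn_ord n.
have -> : (m k.+1 - (m k.+1 - n.+1).+1 = n)%N by lia.
have -> : (m k.+1 - n.+1).+1 = ((m k.+1).+1 - n.+1)%N by lia.
by rewrite (char_sub _ (_ : n.+1 <= (m k.+1).+1)%N) ?rmorphM /=; [ring|lia].
Qed.

(** The old block and the reflected one have disjoint supports, so their squares add; reflection and
    conjugation preserve the sum of squares. *)
Lemma sum_nsq_coefS k : \sum_(n < m k.+1) nsq (coef k.+1 n) =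
  (1 + nsq (g k.+1)) * \sum_(n < m k) nsq (coef k n).
Proof.
have ext : \sum_(n < m k.+1) nsq (coef k n) = \sum_(n < m k) nsq (coef k n).
  rewrite -!(big_mkord xpredT (fun n => nsq (coef k n))).
  rewrite (@big_cat_nat _ _ _ (m k) 0 (m k.+1)) //=; last by have := m2 k; lia.
  rewrite [X in _ + X]big_nat [X in _ + X]big1 ?addr0//.
  by move=> n /andP[kn _]; rewrite coef_out// nsq0.
have -> : \sum_(n < m k.+1) nsq (coef k.+1 n) = \sum_(n < m k.+1)
   (nsq (coef k n) + nsq (g k.+1) * nsq (coef k (m k.+1 - n.+1))).
  apply: eq_bigr => n _; rewrite /= ltn_ord.
  case: (ltnP n (m k)) => nk.
    rewrite (@coef_out k (_ - _)) ?conjc0 ?mulr0 ?nsq0 ?mulr0 ?addr0//.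
    by have := m2 k; lia.
  by rewrite coef_out// nsq0 !add0r nsqM nsq_conj.
rewrite big_split /= -mulr_sumr ext [in RHS]mulrDl mul1r; congr (_ + _ * _).
by rewrite -ext [RHS](reindex_inj rev_ord_inj).
Qed.

(** The energy of [coef 0] is kept as a constant: when [m 0 = 1] its two monomials coincide and
    their squares need not add. *)
Lemma sum_nsq_coef k : \sum_(n < m k) nsq (coef k n) <=
  (\prod_(j < k.+1) (1 + nsq (g j))) * \sum_(n < m 0%N) nsq (coef 0 n).
Proof.
have p j : 1 <= 1 + nsq (g j) by rewrite lerDl nsq_ge0.
elim: k => [|k IH].
  rewrite big_ord_recl big_ord0 mulr1 ler_peMl//.
  by apply: sumr_ge0 => n _; exact: nsq_ge0.
rewrite sum_nsq_coefS big_ord_recr /= [X in _ <= X * _]mulrC -mulrA.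
by apply: ler_wpM2l => //; exact: le_trans ler01 (p _).
Qed.

(** Since n < m_n, the diagonal value [coef n n] is already final. All orbits are thus truncations
    of a single power series. *)
Lemma lac_orbit_limit_coef k t :
  lac_orbit g m k.+1 t = \sum_(n < m k) coef n n * char n.+1 t.
Proof.
rewrite lac_orbit_coef; apply: eq_bigr => n _; congr (_ * _).
case: (leqP k n) => kn; first by rewrite -(coef_stable kn).
by rewrite (coef_stable (ltnW kn) (lacunary_gt n)).
Qed.

Lemma Re_lac_orbit k t : complex.Re (lac_orbit g m k.+1 t) =
  trig (fun n => complex.Re (coef n n)) (fun n => - complex.Im (coef n n)) (m k) t.
Proof.
rewrite lac_orbit_limit_coef raddf_sum /=; apply: eq_bigr => n _.
by rewrite /wave /freq /char /expi; case: (coef n n) => a b /=; rewrite mulNr.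
Qed.

Lemma Im_lac_orbit k t : complex.Im (lac_orbit g m k.+1 t) =
  trig (fun n => complex.Im (coef n n)) (fun n => complex.Re (coef n n)) (m k) t.
Proof.
rewrite lac_orbit_limit_coef raddf_sum /=; apply: eq_bigr => n _.
by rewrite /wave /freq /char /expi; case: (coef n n) => a b /=; ring.
Qed.

Lemma lac_orbit_ae_cvg (M : R) : (forall k, \prod_(j < k) (1 + nsq (g j)) <= M) ->
  (@lebesgue_measure R).-negligible (`[0, 1[ `&` ~` [set t |
    cvgn (fun N => complex.Re (lac_orbit g m N t)) /\
    cvgn (fun N => complex.Im (lac_orbit g m N t))]).
Proof.
move=> HM; pose a n := coef n n.
pose C0 := \sum_(n < m 0%N) nsq (coef 0 n).
have C00 : 0 <= C0 by apply: sumr_ge0 => n _; exact: nsq_ge0.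
have aM L : \sum_(n < L) nsq (a n) <= M * C0.
  apply: (@le_trans _ _ (\sum_(n < m L) nsq (coef L n))).
    rewrite -!(big_mkord xpredT (fun n => nsq (_ n))).
    rewrite [leRHS](@big_cat_nat _ _ _ L 0 (m L)) //=; last exact/ltnW/lacunary_gt.
    rewrite ler_wpDr ?sumr_ge0//; first by move=> *; exact: nsq_ge0.
    rewrite !big_nat le_eqVlt; apply/orP; left; apply/eqP; apply: eq_bigr => n /= nL.
    by rewrite /a (coef_stable (ltnW nL) (lacunary_gt n)).
  by apply: le_trans (sum_nsq_coef L) _; apply: ler_wpM2r.
have ER L : energy (fun n => complex.Re (a n)) (fun n => - complex.Im (a n)) L <= M * C0.
  by apply: le_trans (aM L); rewrite /energy ler_sum// => n _; rewrite sqrrN.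
have EI L : energy (fun n => complex.Im (a n)) (fun n => complex.Re (a n)) L <= M * C0.
  by apply: le_trans (aM L); rewrite /energy ler_sum// => n _; rewrite addrC.
have N1 := kolmogorov_lacunary m0 m2 ER.
have N2 := kolmogorov_lacunary m0 m2 EI.
(* The cut at [m k] is the orbit at step k+1, so convergence is transferred through a shift by
   one. *)
apply: negligibleS (negligibleU N1 N2) => t [t01 /= /not_andP[H|H]]; [left|right]; split => //= cv;
  apply: H; [set u := fun N => complex.Re (lac_orbit g m N t)|set u := fun N => complex.Im (lac_orbit g m N t)];
  move/cvg_ex: cv => [l ul]; apply/cvg_ex; exists l; rewrite -cvg_shiftS /=.
  by under eq_fun do rewrite /u Re_lac_orbit.
by under eq_fun do rewrite /u Im_lac_orbit.
Qed.

End Coefficients.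
End Recursion.

(** * Convergence of complex sequences by real and imaginary parts *)

Section ComplexCvg.
Context {R : realType}.
Local Notation C := (R[i]).

Definition ccvg (u : nat -> C) (l : C) : Prop :=
  ((fun N => complex.Re (u N)) @ \oo --> complex.Re l) /\
  ((fun N => complex.Im (u N)) @ \oo --> complex.Im l).

Lemma ccvg_cst (l : C) : ccvg (fun=> l) l.
Proof. by split; exact: cvg_cst. Qed.

Lemma ccvgD u v k l : ccvg u k -> ccvg v l -> ccvg (fun N => u N + v N) (k + l).
Proof.
move=> [u1 u2] [v1 v2]; rewrite /ccvg !raddfD.
by split; under eq_fun do rewrite raddfD; exact: cvgD.
Qed.

Lemma ReM (z w : C) : complex.Re (z * w) =
  complex.Re z * complex.Re w - complex.Im z * complex.Im w.
Proof. by case: z w => [a b] [c d]. Qed.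

Lemma ImM (z w : C) : complex.Im (z * w) =
  complex.Re z * complex.Im w + complex.Im z * complex.Re w.
Proof. by case: z w => [a b] [c d]. Qed.

Lemma ccvgM u v k l : ccvg u k -> ccvg v l -> ccvg (fun N => u N * v N) (k * l).
Proof.
move=> [u1 u2] [v1 v2]; rewrite /ccvg ReM ImM; split.
  by under eq_fun do rewrite ReM; apply: cvgB; exact: cvgM.
by under eq_fun do rewrite ImM; apply: cvgD; exact: cvgM.
Qed.

Lemma Re_conjc (z : C) : complex.Re (conjc z) = complex.Re z.
Proof. by case: z. Qed.

Lemma Im_conjc (z : C) : complex.Im (conjc z) = - complex.Im z.
Proof. by case: z. Qed.

Lemma ccvg_conj u l : ccvg u l -> ccvg (fun N => conjc (u N)) (conjc l).
Proof.
move=> [u1 u2]; rewrite /ccvg Re_conjc Im_conjc; split.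
  by under eq_fun do rewrite Re_conjc.
by under eq_fun do rewrite Im_conjc; exact: cvgN.
Qed.

Lemma ccvg_real (u : nat -> R) (l : R) : u @ \oo --> l -> ccvg (fun N => (u N)%:C) l%:C.
Proof. by move=> ul; split => //; exact: cvg_cst. Qed.

Lemma ccvg_nsq u l : ccvg u l -> (fun N => nsq (u N)) @ \oo --> nsq l.
Proof.
move=> [u1 u2]; rewrite /nsq !expr2; under eq_fun do rewrite !expr2.
by apply: cvgD; exact: cvgM.
Qed.

End ComplexCvg.

(** * First rows of the partial products and the scalar recursion *)

Section PartialProducts.
Context {R : realType}.
Local Notation C := (R[i]).

Lemma conjcD (z w : C) : conjc (z + w) = conjc z + conjc w.
Proof. exact: rmorphD. Qed.

Lemma conjcM (z w : C) : conjc (z * w) = conjc z * conjc w.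
Proof. exact: rmorphM. Qed.

Definition su11_mx (a b : C) : 'M[C]_2 :=
  \matrix_(r < 2, c < 2)
    (if r == ord0 then (if c == ord0 then a else b)
     else (if c == ord0 then conjc b else conjc a)).

(** The SU(1,1) shape is preserved by each factor, so the products are governed by their first row
    alone. *)
Lemma su11_mxM (a b : C) (A : R) (B : C) (m : nat) (t : R) :
  su11_mx a b * su11_factor A B m t =
  su11_mx (a * A%:C + b * (conjc B * conjc (char m t))) (a * (B * char m t) + b * A%:C).
Proof.
apply/matrixP => r c; rewrite !mxE !big_ord_recl big_ord0 !mxE addr0 /=.
rewrite -conj_expi -/(char m t); set z := char m t.
have -> : Num.conj B = conjc B by [].
case: r c => [[|[|//]] ?] [[|[|//]] ?]; rewrite -?(inj_eq val_inj) [LHS]/= [RHS]/= //.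
  rewrite -[RHS]/(conjc (a * (B * z) + b * A%:C)).
  by rewrite conjcD !conjcM conjc_real addrC.
rewrite -[RHS]/(conjc (a * A%:C + b * (conjc B * conjc z))).
by rewrite conjcD !conjcM !conjcK conjc_real addrC.
Qed.

Fixpoint first_row (A : nat -> R) (B : nat -> C) (m : nat -> nat) (N : nat) (t : R) : C * C :=
  if N is k.+1 then
    let: (a, b) := first_row A B m k t in
    (a * (A k)%:C + b * (conjc (B k) * conjc (char (m k) t)),
     a * (B k * char (m k) t) + b * (A k)%:C)
  else (1, 0).

Lemma first_rowS A B m N t : first_row A B m N.+1 t =
  ((first_row A B m N t).1 * (A N)%:C +
     (first_row A B m N t).2 * (conjc (B N) * conjc (char (m N) t)),
   (first_row A B m N t).1 * (B N * char (m N) t) + (first_row A B m N t).2 * (A N)%:C).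
Proof. by rewrite /first_row -/first_row; case: (first_row _ _ _ _ _). Qed.

Lemma partial_prod_su11 A B m t N :
  partial_prod (fun j => su11_factor (A j) (B j) (m j) t) N =
  su11_mx (first_row A B m N t).1 (first_row A B m N t).2.
Proof.
rewrite /partial_prod; elim: N => [|N IH].
  rewrite big_ord0; apply/matrixP => r c; rewrite !mxE /=.
  case: r c => [[|[|//]] ?] [[|[|//]] ?] //=.
    by rewrite oppr0.
  by rewrite oppr0.
by rewrite big_ord_recr [LHS]/= IH su11_mxM first_rowS.
Qed.

Lemma first_row_det A B m t N : (forall j, A j ^+ 2 - nsq (B j) = 1) ->
  nsq (first_row A B m N t).1 - nsq (first_row A B m N t).2 = 1.
Proof.
move=> AB; elim: N => [|N IH].
  by rewrite /nsq /= !expr0n /= !addr0 expr1n subr0.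
rewrite first_rowS; case: (first_row _ _ _ _ _) IH => a b IH.
cbn [fst snd] in IH |- *.
have zz : nsq (char (m N) t) = 1 by rewrite /nsq /char /expi /= cos2Dsin2.
(* The unimodular phase is absorbed into [B N]; what remains is multiplicativity of the determinant,
   a polynomial identity. *)
have := AB N; rewrite -[nsq (B N)]mulr1 -zz -nsqM -conjcM.
move: (B N * _) => [w1 w2]; case: a b IH => [a1 a2] [b1 b2] IH Aw.
by rewrite -[RHS]mulr1 -{1}IH -Aw /nsq /=; ring.
Qed.

(** For u = z conj(a) + s b, one factor gives A u + B z^m (z conj(b) + s a). As s is real with s^2 =
    1, the last bracket is s z conj(u), which decouples the two cases s = 1 and s = -1. *)
Lemma first_row_orbit (A : nat -> R) (B : nat -> C) m t (s : C) N :
  (forall j, 0 < A j) -> conjc s = s -> s * s = 1 ->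
  char 1 t * conjc (first_row A B m N t).1 + s * (first_row A B m N t).2 =
  (\prod_(j < N) A j)%:C * lac_orbit (fun j => s * (B j / (A j)%:C)) m N t.
Proof.
move=> A0 sR ss; elim: N => [|N IH].
  by rewrite big_ord0 /= oppr0 mulr1 mulr0 addr0 mul1r.
rewrite big_ord_recr first_rowS lac_orbitS.
set X := lac_orbit _ _ _ _ in IH *; set P := \prod_(j < N) _ in IH *.
case: (first_row _ _ _ _ _) IH => a b IH.
cbn [fst snd] in IH |- *.
have A0' : (A N)%:C != 0 by rewrite eq_complex /= eqxx andbT gt_eqF.
have cX : P%:C * conjc X = conjc (char 1 t) * a + s * conjc b.
  have := congr1 (@conjc R) IH; rewrite conjcD !conjcM conjcK sR conjc_real.
  by move=> ->.
have -> : (P * A N)%:C * (X + s * (B N / (A N)%:C) * char (m N).+1 t * conjc X) =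
  (A N)%:C * (P%:C * X) +
  s * B N * char (m N).+1 t * (P%:C * conjc X).
  by rewrite rmorphM /=; field.
rewrite -IH cX -[(m N).+1]addn1 charD conjcD !conjcM !conjcK conjc_real.
have c1 := char_conjM 1 t.
set z := char (m N) t; set c := char 1 t in c1 *.
have -> : s * B N * (z * c) * (conjc c * a + s * conjc b) =
  s * B N * z * a * (c * conjc c) + B N * z * c * conjc b * (s * s) by ring.
by rewrite c1 ss; ring.
Qed.

End PartialProducts.

(** * Bounds for products of weights *)

Section Weights.
Context {R : realType}.

Lemma prod_le_exp_series (u : nat -> R) : (forall j, 1 <= u j) ->
  cvgn (series (fun j => ln (u j))) ->
  forall k, \prod_(j < k) u j <= expR (limn (series (fun j => ln (u j)))).
Proof.
move=> u1 cu k.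
have -> : \prod_(j < k) u j = expR (series (fun j => ln (u j)) k).
  rewrite /series /= big_mkord expR_sum; apply: eq_bigr => j _.
  by rewrite lnK// posrE (lt_le_trans ltr01).
rewrite ler_expR; apply: nondecreasing_cvgn_le => //.
by apply: nondecreasing_series => n _ _; exact: ln_ge0.
Qed.

Lemma prod_cvg (A : nat -> R) (M : R) : (forall j, 1 <= A j) ->
  (forall k, \prod_(j < k) A j <= M) -> cvgn (fun k => \prod_(j < k) A j).
Proof.
move=> A1 AM; apply: nondecreasing_is_cvgn; last first.
  by exists M => _ [k _ <-].
apply/nondecreasing_seqP => k; rewrite big_ord_recr /= ler_peMr//.
by apply: prodr_ge0 => j _; exact: le_trans ler01 (A1 j).
Qed.

End Weights.

(** * Almost everywhere convergence of the matrix products *)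

Unset Implicit Arguments.

Theorem theorem1p2 (R : realType) (q : R) (m : nat -> nat)
    (A : nat -> R) (B : nat -> R[i])
    (hq : 2 <= q)
    (hm_pos : forall j, (0 < m j)%N)
    (hm_incr : forall j, (m j < m j.+1)%N)
    (hm_lac : forall j, q * (m j)%:R <= (m j.+1)%:R)
    (hA_pos : forall j, 0 < A j)
    (hAB : forall j, A j ^+ 2 - normc (B j) ^+ 2 = 1)
    (hsum : cvgn (series (fun j => ln (A j ^+ 2 + normc (B j) ^+ 2)))) :
  (@lebesgue_measure R).-negligible
    (`[0%R, 1%R[ `&`
     ~` [set t : R | exists G : 'M[R[i]]_2,
           SU11 G /\
           mx_cvg_to (partial_prod (fun j => su11_factor (A j) (B j) (m j) t)) G]).
Proof.
have m2 k : (2 * m k <= m k.+1)%N.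
  rewrite -(ler_nat R) natrM; apply: le_trans (hm_lac k).
  by apply: ler_wpM2r.
have AB j : A j ^+ 2 - nsq (B j) = 1 by rewrite -normc_sqr.
have A1 j : 1 <= A j.
  rewrite -(@expr_ge1 _ 2 (A j))//; last exact: ltW.
  by have := nsq_ge0 (B j); have := AB j; lra.
(* This weight dominates both A_j and 1 + |B_j/A_j|^2, because 1 + |B_j|^2 = A_j^2; one constant [M]
   therefore bounds both products. *)
pose w j := A j ^+ 2 + normc (B j) ^+ 2.
have w1 j : 1 <= w j.
  rewrite /w normc_sqr; have := nsq_ge0 (B j); have := AB j; lra.
pose M := expR (limn (series (fun j => ln (w j)))).
have wM k : \prod_(j < k) w j <= M by apply: prod_le_exp_series.
have cP : cvgn (fun k => \prod_(j < k) A j).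
  apply: (@prod_cvg _ _ M) => // k; apply: le_trans (wM k); apply: ler_prod => j _.
  rewrite ltW ?hA_pos//=; apply: (@le_trans _ _ (A j ^+ 2)).
    by rewrite expr2 ler_peMr// ltW.
  by rewrite lerDl sqr_ge0.
pose g (s : R[i]) j := s * (B j / (A j)%:C).
have gM (s : R[i]) : nsq s = 1 -> forall k, \prod_(j < k) (1 + nsq (g s j)) <= M.
  move=> s1 k; apply: le_trans (wM k); apply: ler_prod => j _.
  rewrite addr_ge0 ?nsq_ge0//= /g nsqM s1 mul1r.
  have Aj := hA_pos j.
  have E : nsq (B j / (A j)%:C) * A j ^+ 2 = nsq (B j).
    have -> : A j ^+ 2 = nsq (A j)%:C by rewrite /nsq /= expr0n addr0.
    rewrite -nsqM divfK// eq_complex /= eqxx andbT gt_eqF//.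
  have : nsq (B j / (A j)%:C) <= nsq (B j).
    rewrite -[leRHS]E ler_peMr ?nsq_ge0// expr_ge1 ?A1// ltW//.
  rewrite /w normc_sqr; have := AB j; have := nsq_ge0 (B j); lra.
have s1 : nsq (1 : R[i]) = 1 by rewrite /nsq /= expr1n expr0n addr0.
have sN1 : nsq (-1 : R[i]) = 1 by rewrite /nsq /= sqrrN oppr0 expr1n expr0n addr0.
have N1 := lac_orbit_ae_cvg (hm_pos 0%N) m2 (gM 1 s1).
have N2 := lac_orbit_ae_cvg (hm_pos 0%N) m2 (gM (-1) sN1).
apply: negligibleS (negligibleU N1 N2) => t [t01 noG].
apply: contrapT => /not_orP[] /not_andP[//|/contrapT[/cvg_ex[x1 cx1] /cvg_ex[x2 cx2]]].
move=> /not_andP[//|/contrapT[/cvg_ex[y1 cy1] /cvg_ex[y2 cy2]]].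
apply: noG.
have /cvg_ex[p cp] := cP.
pose X N := lac_orbit (g 1) m N t; pose Y N := lac_orbit (g (-1)) m N t.
have cX : ccvg X (x1 +i* x2) by [].
have cY : ccvg Y (y1 +i* y2) by [].
pose P N := (\prod_(j < N) A j)%:C.
have cPc : ccvg P p%:C by exact: ccvg_real.
pose a N := (first_row A B m N t).1; pose b N := (first_row A B m N t).2.
have EX N : char 1 t * conjc (a N) + b N = P N * X N.
  by rewrite -[b N]mul1r; apply: first_row_orbit; rewrite ?mulr1 ?conjc1.
have EY N : char 1 t * conjc (a N) - b N = P N * Y N.
  rewrite -mulN1r; apply: first_row_orbit => //; last by rewrite mulrNN mulr1.
  by rewrite raddfN /= oppr0.
have two0 : (2 : R[i]) != 0 by rewrite pnatr_eq0.
(* Half the difference of the two orbits, rescaled by [P], is b; half their sum is z conj(a), from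
   which conjugation and a factor z recover a. *)
have Eb : b = fun N => 2^-1 * (P N * X N + -1 * (P N * Y N)).
  by apply/funext => N; rewrite -EX -EY; field.
have Ea : a = fun N => char 1 t * conjc (2^-1 * (P N * X N + P N * Y N)).
  apply/funext => N; rewrite -EX -EY.
  have -> : 2^-1 * (char 1 t * conjc (a N) + b N + (char 1 t * conjc (a N) - b N)) =
    char 1 t * conjc (a N) by field.
  by rewrite conjcM conjcK mulrA char_conjM mul1r.
have cPX := ccvgM cPc cX; have cPY := ccvgM cPc cY.
have [lb cb] : exists l, ccvg b l.
  rewrite Eb; eexists; apply: (ccvgM (ccvg_cst _)).
  exact: (ccvgD cPX (ccvgM (ccvg_cst _) cPY)).
have [la ca] : exists l, ccvg a l.
  rewrite Ea; eexists; apply: (ccvgM (ccvg_cst _)); apply: ccvg_conj.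
  exact: (ccvgM (ccvg_cst _) (ccvgD cPX cPY)).
exists (su11_mx la lb); split.
  exists la, lb; split=> //; rewrite !normc_sqr.
  (* The determinant is 1 along the sequence and continuous, so the limit stays in SU(1,1). *)
  have c1 : (fun=> 1 : R) @ \oo --> nsq la - nsq lb.
    rewrite (_ : (fun=> 1) = (fun N => nsq (a N) - nsq (b N))).
      by apply: cvgB; exact: ccvg_nsq.
    by apply/funext => N; rewrite first_row_det.
  by rewrite -(cvg_lim _ c1)// lim_cst.
have EN : partial_prod (fun j => su11_factor (A j) (B j) (m j) t) = fun N => su11_mx (a N) (b N).
  by apply/funext => N; exact: partial_prod_su11.
rewrite EN => r c; rewrite -[_ /\ _]/(ccvg (fun N => su11_mx (a N) (b N) r c) _) mxE.
have -> : (fun N => su11_mx (a N) (b N) r c) = (fun N =>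
    if r == ord0 then if c == ord0 then a N else b N
    else if c == ord0 then conjc (b N) else conjc (a N)).
  by apply/funext => N; rewrite mxE.
by case: ifP => _; case: ifP => _ //; exact: ccvg_conj.
Qed.
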